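(* There exists an absolute constant $m_0$ such that the following holds for every integer $m\ge m_0$. Let $q=2^m$, let $a,b,c\in\mathbb{F}_{q^4}$, and let $P_4(x)=ax^{q+1}+bx^{q^2+1}+cx^{q^3+1}\in\mathbb{F}_{q^4}[x]$. Then $P_4$ is a planar function on $\mathbb{F}_{q^4}$ if and only if one of the following holds: (i) $(a,b,c)=\Big(0,\ \dfrac{s_1^{q^2}}{1+s_1^{1+q^2}},\ 0\Big)$ for some $s_1\in\mathbb{F}_{q^4}$ with $1+s_1^{1+q^2}\neq 0$; or (ii) $(a,b,c)=\Bigg(\dfrac{s_2^{q+q^2+q^3}}{1+s_2^{1+q+q^2+q^3}},\ \dfrac{s_2^{q^2+q^3}}{1+s_2^{1+q+q^2+q^3}},\ \dfrac{s_2^{q^3}}{1+s_2^{1+q+q^2+q^3}}\Bigg)$ for some $s_2\in\mathbb{F}_{q^4}$ with $1+s_2^{1+q+q^2+q^3}\neq 0$.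
   Context: A function $f:\mathbb{F}_{2^n}\to\mathbb{F}_{2^n}$ is called planar if for every $a\in\mathbb{F}_{2^n}^{*}$ the map $x\mapsto f(x+a)+f(x)+ax$ is a permutation of $\mathbb{F}_{2^n}$. *)

(* Defs.v *)
From HB Require Import structures.
From mathcomp Require Import all_boot all_order all_algebra all_fingroup all_field.
Set Implicit Arguments. Unset Strict Implicit. Unset Printing Implicit Defensive.
Import GRing.Theory.
Local Open Scope ring_scope.

Definition planar (F : finFieldType) (f : F -> F) : Prop :=
  forall a : F, a != 0 -> bijective (fun x : F => f (x + a) + f x + a * x).

Definition P4 (F : finFieldType) (q : nat) (a b c : F) (x : F) : F :=
  a * x ^+ (q + 1) + b * x ^+ (q ^ 2 + 1) + c * x ^+ (q ^ 3 + 1).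

(* Main.v *)
(* Write q = 2^m and x_i = x^(q^i).  Planarity of P_4 means that the commutative product
   x * y = xy + a (x_1 y + x y_1) + b (x_2 y + x y_2) + c (x_3 y + x y_3) has no zero divisors.
   The bilinear form Tr(x^2 (y * z)) has, in the coordinates y_i, z_i, the matrix A + (x_i x_j) with A
   alternating, and in characteristic 2 its determinant is the square of the Pfaffian G(x) of A.  So a
   planar P_4 gives a quartic form G without nontrivial zeros.  Instead of estimating the number of
   points of the surface G = 0, one uses that h = G / (x_0 x_1 x_2 x_3) takes values in F_q, so that
   h^(q-1) = 1 on nonzero x: all power sums of x^(-n) h(x)^(q-1) with q^4-1 not dividing n vanish.
   The exponents of h lie in {-1,0,1}, hence the coefficients of h^(q-1) = h h^2 h^4 ... can be
   computed bit by bit, and three exponents n already suffice.  The first one gives ac^q in F_q with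
   absolute trace 0; by Hilbert 90 one may then assume a, c in F_q, and the other two become
   polynomial identities in a, b, c which force b = (a+c)^2 and b^2 = ac, that is (ii) with s = b/c.
   If a = c = 0 then G is the norm of the binary form b x_0^2 + x_0 x_2 + b_2 x_2^2, which is treated
   by solving u^2 + u = b b_2.  Conversely, in case (ii) the substitution x = s_3 X + X_1 turns the
   product into s_3^2 XY + (XY)_1, and similarly for (i). *)
Require Import Defs.
From HB Require Import structures.
From mathcomp Require Import all_boot all_order all_algebra all_fingroup all_field.
From mathcomp Require Import ring zify.
Import Order.TTheory GRing.Theory Num.Theory.
Local Open Scope ring_scope.

(** * Carries between signed expansions in base Q *)

Lemma carry_bound (Q n0 n1 n2 n3 : int) : 8 <= Q -> 0 <= n0 -> 0 <= n1 -> 0 <= n2 -> 0 <= n3 ->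
    Q * n0 <= n3 + Q + 2 -> Q * n1 <= n0 + Q + 2 -> Q * n2 <= n1 + Q + 2 -> Q * n3 <= n2 + Q + 2 ->
  [/\ n0 <= 1, n1 <= 1, n2 <= 1 & n3 <= 1].
Proof.
move=> Q8 p0 p1 p2 p3 D0 D1 D2 D3.
(* Adding the four bounds gives (Q - 1) S <= 4 Q + 8 for the sum S, so S >= 6 would force Q <= 7.
   This is where Q >= 8, hence m >= 3, enters. *)
have S5 : n0 + n1 + n2 + n3 <= 5.
  rewrite leNgt; apply/negP => S6.
  have : (Q - 1) * 6 <= (Q - 1) * (n0 + n1 + n2 + n3).
    by apply: ler_wpM2l; [clear -Q8|clear -S6]; lia.
  have -> : (Q - 1) * (n0 + n1 + n2 + n3) = Q * n0 + Q * n1 + Q * n2 + Q * n3 - (n0 + n1 + n2 + n3).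
    by ring.
  by clear S6 p0 p1 p2 p3; lia.
have le1 k k' : Q * k <= k' + Q + 2 -> k' <= 5 -> k <= 1.
  move=> Dk k'5; rewrite leNgt; apply/negP => k2.
  have : Q * 2 <= Q * k by apply: ler_wpM2l; clear -Q8 k2; lia.
  by clear -Dk k'5 Q8; lia.
by split; [apply: le1 D0 _|apply: le1 D1 _|apply: le1 D2 _|apply: le1 D3 _];
  clear -S5 p0 p1 p2 p3; lia.
Qed.

Lemma carry_step (Q k k' d e : int) : 0 <= Q -> d = e + Q * k - k' -> `|d| < Q -> `|e| <= 3 ->
  Q * `|k| <= `|k'| + Q + 2.
Proof.
move=> Q0 -> lt_d le_e; have -> : Q * `|k| = `|Q * k| by rewrite normrM (ger0_norm Q0).
by move: (Q * k) lt_d => P; lia.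
Qed.

Lemma int_norm_le1 (k : int) : -1 <= k <= 1 -> [\/ k = -1, k = 0 | k = 1].
Proof.
move=> Kk; have : k = -1 \/ k = 0 \/ k = 1 by lia.
by case=> [|[]]; [constructor 1|constructor 2|constructor 3].
Qed.

(** A finite check for the digits (e0, -1, e2, 0). The nonzero survivor turns them into (e0 - Q, 0,
    e2 + Q, -1), whose third digit is below Q only if e2 < 0. *)
Lemma carry_cases (Q e0 e2 k0 k1 k2 k3 : int) : 8 <= Q -> 1 <= e0 <= 3 -> -2 <= e2 <= 0 ->
    [/\ -1 <= k0 <= 1, -1 <= k1 <= 1, -1 <= k2 <= 1 & -1 <= k3 <= 1] -> k0 + k1 + k2 + k3 = 0 ->
    `|e0 + Q * k0 - k3| < Q -> `|-1 + Q * k1 - k0| < Q ->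
    `|e2 + Q * k2 - k1| < Q -> `|0 + Q * k3 - k2| < Q ->
  (k0, k1, k2, k3) = (0, 0, 0, 0) \/ ((k0, k1, k2, k3) = (-1, 0, 1, 0) /\ e2 < 0).
Proof.
move=> Q8 E0 E2 [K0 K1 K2 K3].
case: (int_norm_le1 k0 K0) => ->; case: (int_norm_le1 k1 K1) => ->; case: (int_norm_le1 k2 K2) => ->;
  case: (int_norm_le1 k3 K3) => -> sum_k; try by [].
all: clear K0 K1 K2 K3; rewrite ?mulrN1 ?mulr0 ?mulr1 => B0 B1 B2 B3.
all: first [by left | exfalso; lia | right; split=> //; lia].
Qed.

(* Locked: otherwise rewriting with frobX would also unfold [frob m x] into a power. *)
HB.lock Definition frob (F : fieldType) (m : nat) (x : F) : F := x ^+ (2 ^ m).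

(** * The Frobenius map x -> x^q and q-polynomials *)

Section Planar.
Variables (F : finFieldType) (m : nat).
Hypotheses (cardF : #|F| = (2 ^ (4 * m))%N) (m_gt2 : (2 < m)%N).
Local Notation q := (2 ^ m)%N.
Local Notation phi := (frob F m).
Implicit Types x y z : F.

Lemma pchar2 : 2%N \in [pchar F].
Proof. exact: (card_finPcharP cardF). Qed.

Lemma two0 : 2%:R = 0 :> F.
Proof. by move/andP: pchar2 => [_ /eqP]. Qed.

Lemma frobQ x : phi x = x ^+ q.
Proof. by rewrite frob.unlock. Qed.

Lemma frobD x y : phi (x + y) = phi x + phi y.
Proof. by rewrite !frobQ exprDn_pchar // pnatX pnatE ?pchar2. Qed.
Lemma frobM x y : phi (x * y) = phi x * phi y.
Proof. by rewrite !frobQ exprMn. Qed.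
Lemma frobV x : phi x^-1 = (phi x)^-1.
Proof. by rewrite !frobQ exprVn. Qed.
Lemma frob1 : phi 1 = 1.
Proof. by rewrite frobQ expr1n. Qed.
Lemma frob0 : phi 0 = 0.
Proof. by rewrite !frobQ expr0n expn_eq0. Qed.
Lemma frobX x n : phi (x ^+ n) = phi x ^+ n.
Proof. by rewrite !frobQ exprAC. Qed.
Lemma frob_eq0 x : (phi x == 0) = (x == 0).
Proof. by rewrite frobQ expf_eq0 expn_gt0. Qed.
Lemma frob4 x : phi (phi (phi (phi x))) = x.
Proof.
rewrite !frobQ -!exprM -!expnD; have -> : (m + (m + (m + m)) = 4 * m)%N by lia.
by rewrite -cardF expf_card.
Qed.

Definition frobE := (frobD, frobM, frobV, frobX, frob1, frob0, frob4).

Lemma addFF x : x + x = 0.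
Proof. by rewrite -mulr2n -mulr_natr two0 mulr0. Qed.

Lemma eq_of_add0 x y : x + y = 0 -> x = y.
Proof. by move=> e; rewrite -[x]addr0 -(addFF y) addrA e add0r. Qed.

Lemma frob_inj : injective phi.
Proof.
move=> x y e; apply/eq_of_add0/eqP.
by rewrite -frob_eq0 frobD e addFF.
Qed.

(** As a polynomial in y the left side has degree at most q^3, but q^4 roots. *)
Lemma qpoly_eq0 (v0 v1 v2 v3 : F) :
    (forall y, v0 * y + v1 * phi y + v2 * phi (phi y) + v3 * phi (phi (phi y)) = 0) ->
  [/\ v0 = 0, v1 = 0, v2 = 0 & v3 = 0].
Proof.
move=> h.
pose p : {poly F} := v0 *: 'X^1 + v1 *: 'X^q + v2 *: 'X^(q * q) + v3 *: 'X^(q * q * q).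
have q_gt1 : (1 < q)%N by rewrite -{1}(expn0 2) ltn_exp2l //; lia.
have size_p : (size p <= (q * q * q).+1)%N.
  have sz (u : F) k : (k <= q * q * q)%N -> (size (u *: 'X^k : {poly F}) <= (q * q * q).+1)%N.
    by move=> le_k; apply: leq_trans (size_scale_leq _ _) _; rewrite size_polyXn.
  have szD (r s : {poly F}) N : (size r <= N)%N -> (size s <= N)%N -> (size (r + s)%R <= N)%N.
    by move=> hr hs; apply: leq_trans (size_polyD _ _) _; rewrite geq_max hr.
  by rewrite /p; apply: (szD); [apply: (szD); [apply: (szD)|]|]; apply: (sz); nia.
have p0 : p = 0.
  apply/eqP; apply: contraT => /max_poly_roots /(_ _ (enum_uniq F)) /= lt_p.
  have : all (root p) (enum F).
    apply/allP => y _; apply/eqP; rewrite -(h y) /p !hornerE.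
    by rewrite !frobQ -!exprM ?mulnA ?expr1.
  move/lt_p/leq_trans/(_ size_p); rewrite -cardE cardF.
  have -> : (2 ^ (4 * m) = q * q * q * q)%N by rewrite -!expnD; congr expn; lia.
  have : (0 < q * q * q)%N by rewrite !muln_gt0 expn_gt0.
  by move: q_gt1; move: (q * q * q)%N => t; nia.
have cf k : p`_k = 0 by rewrite p0 coef0.
have cfE k : p`_k = v0 *+ (k == 1)%N + v1 *+ (k == q)%N + v2 *+ (k == q * q)%N + v3 *+ (k == q * q * q)%N.
  by rewrite /p !coefD !coefZ !coefXn !mulr_natr.
have neq i j : (i < j)%N -> ((i == j) = false) * ((j == i) = false).
  by move=> lt_ij; rewrite (ltn_eqF lt_ij) (gtn_eqF lt_ij).
have lt_q : (q < q * q)%N by nia.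
have lt_qq : (q * q < q * q * q)%N by move: lt_q; move: (q * q)%N => t; nia.
have lt1 := ltn_trans q_gt1 lt_q.
move: (cf 1%N) (cf q) (cf (q * q)%N) (cf (q * q * q)%N); rewrite !cfE !eqxx.
rewrite !(neq _ _ q_gt1, neq _ _ lt_q, neq _ _ lt_qq, neq _ _ lt1).
rewrite !(neq _ _ (ltn_trans lt_q lt_qq), neq _ _ (ltn_trans lt1 lt_qq)).
by rewrite !mulr0n !addr0 !add0r !mulr1n.
Qed.

(** * The product attached to P_4 and its Pfaffian *)

Section Star.
Variables a b c : F.

Definition star x y : F :=
  x * y + a * (phi x * y + x * phi y) + b * (phi (phi x) * y + x * phi (phi y))
        + c * (phi (phi (phi x)) * y + x * phi (phi (phi y))).

Lemma P4_polarization x e : P4 q a b c (x + e) + P4 q a b c x + e * x = star x e + P4 q a b c e.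
Proof.
have E y : P4 q a b c y = a * (phi y * y) + b * (phi (phi y) * y) + c * (phi (phi (phi y)) * y).
  by rewrite /P4 !frobQ !addn1 !exprSr -!exprM !expnS expn0 !muln1 !mulnA.
rewrite !E /star !frobE; ring: two0.
Qed.

(** For fixed e the difference map is the additive map x -> [star x e] plus a constant; on a finite
    field it is bijective exactly when the kernel is trivial. *)
Lemma planar_star : planar (P4 q a b c) <-> (forall x y, star x y = 0 -> x = 0 \/ y = 0).
Proof.
have starD x x' y : star (x + x') y = star x y + star x' y by rewrite /star !frobE; ring.
split=> [pl x e se|st e e0].
  have [->|/pl/bij_inj inj_e] := eqVneq e 0; [by right|left].
  apply: inj_e; rewrite !P4_polarization se.
  by have := starD 0 0 e; rewrite addr0 -{1}(addr0 (star _ _)) => /addrI <-.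
apply: injF_bij => x y; rewrite !P4_polarization => /addIr sxy.
apply: eq_of_add0; case: (st (x + y) e) => //; last by move/eqP: e0.
by rewrite starD sxy addFF.
Qed.

Definition tr x : F := x + phi x + phi (phi x) + phi (phi (phi x)).

(* The adjoint of [star x] for the form [tr (l * _)]. *)
Definition adj l x : F :=
  l * x + (a * l + phi (c * l)) * phi x + (b * l + phi (phi (b * l))) * phi (phi x)
        + (c * l + phi (phi (phi (a * l)))) * phi (phi (phi x)).

Lemma tr_star l x y : tr (l * star x y) = tr (y * adj l x).
Proof. rewrite /tr /star /adj !frobE; ring. Qed.

(* [entry1 x], [entry2 x] and their conjugates are the entries A_01, A_02, ... of the alternating
   matrix A, and [pfaffian x] = A_01 A_23 + A_12 A_30 + A_02 A_13. *)
Definition entry1 x : F := a * x ^+ 2 + x * phi x + phi (c * x ^+ 2).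
Definition entry2 x : F := b * x ^+ 2 + x * phi (phi x) + phi (phi (b * x ^+ 2)).
Definition pfaffian x : F :=
  entry1 x * phi (phi (entry1 x)) + phi (entry1 x) * phi (phi (phi (entry1 x)))
  + entry2 x * phi (entry2 x).

Lemma entry2_frob2 x : phi (phi (entry2 x)) = entry2 x.
Proof. rewrite /entry2 !frobE; ring. Qed.

Hypothesis star_reg : forall x y, star x y = 0 -> x = 0 \/ y = 0.

(** [star x] is additive and injective, hence onto. If [adj l x] vanished, [tr (l * z)] would be 0
    for every z, which forces l = 0. *)
Lemma adj_neq0 l x : l != 0 -> x != 0 -> adj l x != 0.
Proof.
move=> l0 x0; apply/eqP => adj0.
have inj_x : injective (star x).
  move=> y z e; apply: eq_of_add0; have [||//] := star_reg x (y + z); last first.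
    by move/eqP: x0.
  transitivity (star x y + star x z); last by rewrite e addFF.
  by rewrite /star !frobE; ring.
have [g _ gK] := injF_bij inj_x.
have [l00 _ _ _] : [/\ l = 0, phi l = 0, phi (phi l) = 0 & phi (phi (phi l)) = 0].
  apply: qpoly_eq0 => z; rewrite -!frobM.
  by have := tr_star l x (g z); rewrite adj0 mulr0 gK /tr !frob0 !addr0.
by rewrite l00 eqxx in l0.
Qed.

(** A zero of the Pfaffian makes A + (x_i x_j) singular, against [adj_neq0] with l = x^2. A kernel
    element is [p x] if nonzero, else any nonzero [p y]; if p vanishes identically, then A = 0. *)
Lemma pfaffian_neq0 x : x != 0 -> pfaffian x != 0.
Proof.
move=> x0; apply/eqP => G0.
have [u uE] : exists u, u = entry1 x by exists (entry1 x).
have [v vE] : exists v, v = entry2 x by exists (entry2 x).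
(* p y is the 0-th coordinate of the Pfaffian adjoint of A applied to the conjugates of y; its
   kernel property supplies an explicit zero of [adj (x ^+ 2)]. *)
pose p y := phi (phi u) * phi y + phi v * phi (phi y) + phi u * phi (phi (phi y)).
have adjE z : adj (x ^+ 2) z = x * tr (x * z) + u * phi z + v * phi (phi z)
    + phi (phi (phi u)) * phi (phi (phi z)).
  rewrite /adj /tr uE vE /entry1 /entry2 !frobE; ring: two0.
have v2 : phi (phi v) = v by rewrite vE entry2_frob2.
have adj_p y : adj (x ^+ 2) (p y) = x * tr (x * p y) + pfaffian x * y.
  rewrite adjE /pfaffian -uE -vE /p !(frobE, v2); ring: two0.
have tr_p y : tr (x * p y) = tr (y * p x).
  rewrite /tr /p !(frobE, v2); ring.
have tr_pp : tr (x * p x) = 0.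
  rewrite /tr /p !(frobE, v2); ring: two0.
have ker z : z != 0 -> adj (x ^+ 2) z = 0 -> False.
  by move=> z0 /eqP; apply/negP/adj_neq0; rewrite ?expf_neq0.
have [px0|px0] := eqVneq (p x) 0; last first.
  by apply: (ker (p x) px0); rewrite adj_p tr_pp G0 mulr0 mul0r addr0.
have [/forallP p0|] := boolP [forall y, p y == 0]; last first.
  rewrite negb_forall => /existsP [y py0].
  by apply: (ker (p y) py0); rewrite adj_p tr_p px0 G0 mulr0 /tr !frob0 mul0r !addr0 mulr0.
have [] : [/\ 0 = 0 :> F, phi (phi u) = 0, phi v = 0 & phi u = 0].
  by apply: qpoly_eq0 => y; rewrite mul0r add0r; apply/eqP/p0.
move=> _ _ /eqP; rewrite frob_eq0 => /eqP v0 /eqP; rewrite frob_eq0 => /eqP u0.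
(* The map is now z -> x tr(x z); it kills x^-1 since tr 1 = 4 = 0. *)
apply: (ker x^-1); first by rewrite invr_eq0.
by rewrite adjE u0 v0 divff // /tr !frob1 !frob0 addFF add0r addFF mulr0 !mul0r !addr0.
Qed.

End Star.

(** * Expansion of the normalized Pfaffian *)

(* Exponent vectors of Laurent monomials in x, x^q, x^(q^2), x^(q^3). *)
Definition vec : Type := int * int * int * int.

Definition mon x (d : vec) : F :=
  let: (d0, d1, d2, d3) := d in
  x ^ d0 * phi x ^ d1 * phi (phi x) ^ d2 * phi (phi (phi x)) ^ d3.

Definition wt (d : vec) : int :=
  let: (d0, d1, d2, d3) := d in
  d0 + q%:Z * (d1 + q%:Z * (d2 + q%:Z * d3)).

Definition dbl (d e : vec) : vec :=
  let: (d0, d1, d2, d3) := d in let: (e0, e1, e2, e3) := e in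
  (d0 + e0 *+ 2, d1 + e1 *+ 2, d2 + e2 *+ 2, d3 + e3 *+ 2).

(** The constraints that h^(2^n - 1) inherits from h, which is homogeneous of degree 0 with
    exponents in {-1, 0, 1}. *)
Definition balanced n (d : vec) : bool :=
  let: (d0, d1, d2, d3) := d in
  [&& d0 + d1 + d2 + d3 == 0, `|d0| < 2 ^+ n, `|d1| < 2 ^+ n, `|d2| < 2 ^+ n & `|d3| < 2 ^+ n].

Definition laurent (s : seq (F * vec)) x : F := \sum_(t <- s) t.1 * mon x t.2.

Definition coef (s : seq (F * vec)) (d : vec) : F := \sum_(t <- s | t.2 == d) t.1.

Lemma mon_wt x d : x != 0 -> mon x d = x ^ wt d.
Proof.
case: d => [[[d0 d1] d2] d3] x0; rewrite /mon /wt.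
have frob_expz y n : phi y ^ n = y ^ (q%:Z * n) by rewrite frobQ exprnP exprz_exp.
by rewrite !frob_expz -!expfzDr //; congr (_ ^ _); ring.
Qed.

Lemma mon_dbl x d e : x != 0 -> mon x (dbl d e) = mon x d * mon x e ^+ 2.
Proof.
move=> x0; rewrite !mon_wt // exprnP exprz_exp -expfzDr //; congr (_ ^ _).
case: d => [[[d0 d1] d2] d3]; case: e => [[[e0 e1] e2] e3]; rewrite /wt /dbl; ring.
Qed.

Lemma card_units : (q ^ 4)%N = #|[pred x : F | x != 0]|.+1.
Proof.
rewrite -expnM mulnC -cardF (cardD1 0) inE add1n; congr _.+1.
by apply: eq_card => x; rewrite !inE andbT.
Qed.

(** The number q^4 - 1 of units is odd, which gives 1 if every x^n is 1. Otherwise some unit y has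
    y^n different from 1, and replacing x by y x multiplies the sum by y^n. *)
Lemma sum_expz n : \sum_(x : F | x != 0) x ^ n = ((q ^ 4)%:Z - 1 %| n)%Z%:R.
Proof.
have := card_units; set N := #|_| => qN; have q4 : (q ^ 4)%:Z - 1 = N%:Z by lia.
have N_gt0 : (0 < N)%N.
  have : (1 < q ^ 4)%N by rewrite -(expn0 q) ltn_exp2l // -{1}(expn0 2) ltn_exp2l //; lia.
  by rewrite qN.
have expN x : x != 0 -> x ^+ N = 1.
  move=> x0; apply: (mulfI x0); rewrite mulr1 -exprS -qN -expnM mulnC -cardF.
  exact: expf_card.
rewrite q4.
have expz_mod x : x != 0 -> x ^ n = x ^+ `|(n %% N)%Z|.
  move=> x0; rewrite {1}(divz_eq n N) expfzDr // [(_ %/ _)%Z * _]mulrC -exprz_exp -exprnP expN //.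
  rewrite exp1rz mul1r.
  by rewrite exprnP gez0_abs // modz_ge0 //; lia.
rewrite (eq_bigr _ expz_mod); set k := `|(n %% N)%Z|%N.
have ltkN : (k < N)%N by have := @ltz_pmod n N; rewrite /k; lia.
have -> : (N %| n)%Z = (k == 0%N).
  by rewrite /k absz_eq0; apply/dvdz_mod0P/eqP.
have [k0|k0] := eqVneq k 0%N.
  rewrite (eq_bigr (fun=> 1%:R)) => [|x _]; last by rewrite k0 expr0.
  rewrite -natr_sum sum1_card -/N; apply: eq_of_add0; rewrite natr1 -qN.
  by rewrite !natrX two0 expr0n gtn_eqF ?expr0n //; lia.
have [y y0 yk] : exists2 y : F, y != 0 & y ^+ k != 1.
  apply/exists_inP; apply: contraLR ltkN; rewrite negb_exists_in => /forall_inP yk.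
  rewrite -leqNgt /N cardE.
  apply: max_unity_roots; [by rewrite lt0n| |exact: enum_uniq].
  apply/allP => y; rewrite mem_enum => /yk; rewrite negbK => /eqP yk1.
  by apply/unity_rootP.
rewrite -subr_eq0 in yk; apply: (mulfI yk); rewrite mulr0 mulrBl mul1r; apply/eqP; rewrite subr_eq0.
rewrite mulr_sumr; apply/eqP; symmetry; rewrite (reindex_inj (mulfI y0)) /=.
by apply: eq_big => x; [rewrite mulf_eq0 (negPf y0)|rewrite exprMn].
Qed.

Section Terms.
Variables a b c : F.

(* The Laurent polynomial pfaffian / (x_0 x_1 x_2 x_3). *)
Definition terms : seq (F * vec) :=
  let a1 := phi a in let a2 := phi a1 in let a3 := phi a2 in
  let b1 := phi b in let b2 := phi b1 in let b3 := phi b2 in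
  let c1 := phi c in let c2 := phi c1 in let c3 := phi c2 in
  [:: (1, (0, 0, 0, 0));
      (a, (1, -1, 0, 0)); (a1, (0, 1, -1, 0)); (a2, (0, 0, 1, -1)); (a3, (-1, 0, 0, 1));
      (b, (1, 0, -1, 0)); (b1, (0, 1, 0, -1)); (b2, (-1, 0, 1, 0)); (b3, (0, -1, 0, 1));
      (c, (1, 0, 0, -1)); (c1, (-1, 1, 0, 0)); (c2, (0, -1, 1, 0)); (c3, (0, 0, -1, 1));
      (b * b1 + c * a1, (1, 1, -1, -1)); (b2 * b3 + c2 * a3, (-1, -1, 1, 1));
      (b1 * b2 + c1 * a2, (-1, 1, 1, -1)); (b * b3 + a * c3, (1, -1, -1, 1));
      (a * a2 + c * c2, (1, -1, 1, -1)); (a1 * a3 + c1 * c3, (-1, 1, -1, 1))].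

Lemma pfaffian_terms x : x != 0 ->
  pfaffian a b c x = x * phi x * phi (phi x) * phi (phi (phi x)) * laurent terms x.
Proof.
move=> x0; have [x1 x2 x3] : [/\ phi x != 0, phi (phi x) != 0 & phi (phi (phi x)) != 0].
  by rewrite !frob_eq0.
(* In characteristic 0 the two sides differ by twice x_0 x_1 x_2 x_3. *)
rewrite -[RHS]addr0 -(addFF (x * phi x * phi (phi x) * phi (phi (phi x)))).
rewrite /laurent /terms !big_cons big_nil /mon /fst /snd !expr0z !expr1z !exprN1.
rewrite /pfaffian /entry1 /entry2 !frobE.
by field; rewrite x0 x1 x2 x3.
Qed.

End Terms.

Section Expansion.
Variables a b c : F.
Local Notation T := (terms a b c).

(* With h the polynomial [terms], [expansion n] is h^(2^n - 1) = h * (h^(2^(n-1) - 1))^2. *)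
Fixpoint expansion n : seq (F * vec) :=
  if n is n'.+1 then [seq (g.1 * t.1 ^+ 2, dbl g.2 t.2) | g <- T, t <- expansion n']
  else [:: (1, (0, 0, 0, 0))].

Lemma sum_sqr (I : Type) (r : seq I) (P : pred I) (f : I -> F) :
  (\sum_(i <- r | P i) f i) ^+ 2 = \sum_(i <- r | P i) f i ^+ 2.
Proof.
apply: (big_morph (fun x : F => x ^+ 2)) => [x y|]; last by rewrite expr0n.
ring: two0.
Qed.

Lemma laurent_expansion n x : x != 0 -> laurent (expansion n) x = laurent T x ^+ (2 ^ n - 1).
Proof.
move=> x0; elim: n => [|n IH].
  by rewrite expr0 /laurent big_seq1 /mon /= !expr0z !mulr1.
have -> : (2 ^ n.+1 - 1 = ((2 ^ n - 1) * 2).+1)%N.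
  have := expn_gt0 2 n; rewrite expnS; lia.
rewrite exprS exprM -IH /laurent sum_sqr big_allpairs_dep mulr_suml /=.
apply: eq_bigr => g _; rewrite mulr_sumr; apply: eq_bigr => t _ /=.
by rewrite mon_dbl //; ring.
Qed.

Lemma lt_dbl (d u N : int) : `|d| <= 1 -> `|u| < N -> `|d + u *+ 2| < 2 * N.
Proof. lia. Qed.

Lemma balanced_expansion n : all (fun t => balanced n t.2) (expansion n).
Proof.
elim: n => // n IH; apply/allP => t /allpairsP [[g u] [/= gT uE ->]] /=.
have := allP IH u uE; case: u {uE} => ? [[[u0 u1] u2] u3] /= bal_u.
have fin d0 d1 d2 d3 : `|d0| <= 1 -> `|d1| <= 1 -> `|d2| <= 1 -> `|d3| <= 1 ->
    d0 + d1 + d2 + d3 = 0 -> balanced n.+1 (dbl (d0, d1, d2, d3) (u0, u1, u2, u3)).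
  move=> h0 h1 h2 h3 sum_d; case/and5P: bal_u => /eqP sum_u k0 k1 k2 k3.
  apply/and5P; split; rewrite ?exprS; [|exact: lt_dbl..].
  by apply/eqP; rewrite -[RHS](congr1 (fun s => s *+ 2) sum_u) -[RHS]add0r -sum_d; ring.
by move: gT; rewrite !inE; do 18?[case/orP=> [/eqP->|]]; last move=> /eqP ->; apply: fin.
Qed.

Lemma coef_dbl n d : coef (expansion n.+1) d =
  \sum_(g <- T) g.1 * (\sum_(t <- expansion n | dbl g.2 t.2 == d) t.1) ^+ 2.
Proof.
by rewrite /coef big_mkcond big_allpairs_dep /=; apply: eq_bigr => g _;
  rewrite sum_sqr mulr_sumr [RHS]big_mkcond.
Qed.

(** The parity of an exponent g + 2 e is that of g, so an exponent of h (h^k)^2 determines the first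
    factor g up to few choices. *)
Definition par (d : vec) : bool * bool * bool * bool :=
  let: (d0, d1, d2, d3) := d in (odd `|d0|, odd `|d1|, odd `|d2|, odd `|d3|).

Lemma par_dbl d e : par (dbl d e) = par d.
Proof.
case: d => [[[d0 d1] d2] d3]; case: e => [[[e0 e1] e2] e3] /=.
have odd_dbl (u v : int) : odd `|u + v *+ 2| = odd `|u| by lia.
by rewrite !odd_dbl.
Qed.

Lemma dbl_inj d : injective (dbl d).
Proof.
case: d => [[[d0 d1] d2] d3] [[[e0 e1] e2] e3] [[[f0 f1] f2] f3] [] /=.
by move=> *; congr (_, _, _, _); lia.
Qed.

Lemma coef_par n r (x : vec) : coef (expansion n.+1) (dbl r x) =
  \sum_(g <- T | par g.2 == par r)
    g.1 * (\sum_(t <- expansion n | dbl g.2 t.2 == dbl r x) t.1) ^+ 2.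
Proof.
rewrite coef_dbl [RHS]big_mkcond; apply: eq_bigr => g _.
case: eqP => // npar; rewrite big_pred0 ?expr0n ?mulr0 // => t.
by apply/eqP => e; apply: npar; rewrite -(par_dbl r x) -e par_dbl.
Qed.

Lemma coef_shift n (d g y : vec) : d = dbl g y ->
  \sum_(t <- expansion n | dbl g t.2 == d) t.1 = coef (expansion n) y.
Proof.
by move=> ->; apply: eq_bigl => t; apply/eqP/eqP => [/dbl_inj|->].
Qed.

(** A parity class of [terms] with exactly two odd coordinates consists of a vector and its
    opposite, whence a two-term recurrence. *)
Lemma coef_pair n (d g y h z : vec) (u v : F) :
    [seq t <- T | par t.2 == par g] = [:: (u, g); (v, h)] -> d = dbl g y -> d = dbl h z ->
  coef (expansion n.+1) d = u * coef (expansion n) y ^+ 2 + v * coef (expansion n) z ^+ 2.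
Proof.
move=> Tgh dg dh; rewrite {1}dg coef_par -big_filter Tgh !big_cons big_nil addr0.
by rewrite -dg (coef_shift _ _ _ _ dg) (coef_shift _ _ _ _ dh).
Qed.

Lemma coef_unbalanced n (d : vec) : ~~ balanced n d -> coef (expansion n) d = 0.
Proof.
move=> unbal; rewrite /coef big_seq_cond big1 // => t /andP[tE /eqP td].
by have /negP[] := unbal; rewrite -td (allP (balanced_expansion n)).
Qed.

Lemma coef_origin n : coef (expansion n) (0, 0, 0, 0) = 1.
Proof.
elim: n => [|n IH]; first by rewrite /coef big_mkcond big_seq1.
rewrite -[(0, 0, 0, 0)]/(dbl (0, 0, 0, 0) (0, 0, 0, 0)) coef_par -big_filter.
have -> : [seq t <- T | par t.2 == par (0, 0, 0, 0)] = [:: (1, (0, 0, 0, 0))] by lazy.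
by rewrite big_seq1 mul1r (@coef_shift _ _ _ (0, 0, 0, 0)) // IH expr1n.
Qed.

Local Notation C n d := (coef (expansion n) d).

Ltac vec_eq := by rewrite /dbl ?exprS; congr (_, _, _, _); lia.

Lemma coef_e0_e1 n : C n.+1 (1, -1, 0, 0) = a + phi c * C n (1, -1, 0, 0) ^+ 2.
Proof.
rewrite (@coef_pair _ _ (1, -1, 0, 0) (0, 0, 0, 0) (-1, 1, 0, 0) (1, -1, 0, 0) a (phi c)) //.
by rewrite coef_origin expr1n mulr1.
Qed.

Lemma coef_e0_e2 n : C n.+1 (1, 0, -1, 0) = b + phi (phi b) * C n (1, 0, -1, 0) ^+ 2.
Proof.
rewrite (@coef_pair _ _ (1, 0, -1, 0) (0, 0, 0, 0) (-1, 0, 1, 0) (1, 0, -1, 0) b (phi (phi b))) //.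
by rewrite coef_origin expr1n mulr1.
Qed.

Lemma coef_2e0 n : C n.+1 (2, -1, -1, 0) =
  phi a * C n (1, -1, 0, 0) ^+ 2 + phi (phi c) * C n (1, 0, -1, 0) ^+ 2.
Proof. exact: (@coef_pair _ _ (0, 1, -1, 0) _ (0, -1, 1, 0)). Qed.

Lemma coef_3e0 n : C n.+1 (3, -1, -2, 0) =
  a * C n (1, 0, -1, 0) ^+ 2 + phi c * C n (2, -1, -1, 0) ^+ 2.
Proof. exact: (@coef_pair _ _ (1, -1, 0, 0) _ (-1, 1, 0, 0)). Qed.

(** The exponent is extremal: every factor h^(2^i) with i < n must contribute its term from b_2 x_2
    / x_0. *)
Lemma coef_1carry n : C n (1 - 2 ^+ n, 0, 2 ^+ n - 1, 0) = phi (phi b) ^+ (2 ^ n - 1).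
Proof.
elim: n => [|n IH]; first exact: coef_origin.
rewrite (@coef_pair _ _ (1, 0, -1, 0) (- 2 ^+ n, 0, 2 ^+ n, 0) (-1, 0, 1, 0)
           (1 - 2 ^+ n, 0, 2 ^+ n - 1, 0) b (phi (phi b))) //; try vec_eq.
rewrite IH coef_unbalanced.
  rewrite expr0n mulr0 add0r -exprM -exprS; congr (_ ^+ _).
  have := expn_gt0 2 n; rewrite expnS; lia.
by rewrite /balanced; lia.
Qed.

(** For [n.+1 = m] this is the carried form (e0 - q, 0, e2 + q, -1) of (2, -1, -1, 0); the next
    lemma treats (3, -1, -2, 0). *)
Lemma coef_2carry n : C n.+1 (2 - 2 ^+ n.+1, 0, 2 ^+ n.+1 - 1, -1) =
  phi (phi a) * phi (phi b) ^+ (2 ^ n - 1) ^+ 2.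
Proof.
rewrite (@coef_pair _ _ (0, 0, 1, -1) (1 - 2 ^+ n, 0, 2 ^+ n - 1, 0) (0, 0, -1, 1)
           (1 - 2 ^+ n, 0, 2 ^+ n, -1) (phi (phi a)) (phi (phi (phi c)))) //; try vec_eq.
rewrite coef_1carry coef_unbalanced ?expr0n ?mulr0 ?addr0 //.
by rewrite /balanced; lia.
Qed.

Lemma coef_3carry n : C n.+1 (3 - 2 ^+ n.+1, 0, 2 ^+ n.+1 - 2, -1) =
  c * phi (phi b) ^+ (2 ^ n - 1) ^+ 2
  + phi (phi (phi a)) * C n (2 - 2 ^+ n, 0, 2 ^+ n - 1, -1) ^+ 2.
Proof.
rewrite (@coef_pair _ _ (-1, 0, 0, 1) (2 - 2 ^+ n, 0, 2 ^+ n - 1, -1) (1, 0, 0, -1)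
           (1 - 2 ^+ n, 0, 2 ^+ n - 1, 0) (phi (phi (phi a))) c) //; try vec_eq.
by rewrite coef_1carry addrC.
Qed.

Hypothesis nz : forall x, x != 0 -> pfaffian a b c x != 0.

Lemma pfaffian_frob x : phi (pfaffian a b c x) = pfaffian a b c x.
Proof. by rewrite /pfaffian !frobE /entry1 /entry2 !frobE; ring. Qed.

(** The Pfaffian and x_0 x_1 x_2 x_3 are nonzero and fixed by [phi], so their quotient h(x) lies in
    F_q and h(x)^(q-1) = 1. *)
Lemma laurent_expr1 x : x != 0 -> laurent (expansion m) x = 1.
Proof.
move=> x0; have := nz x x0; have := pfaffian_frob x; rewrite laurent_expansion // pfaffian_terms //.
have [x1 x2 x3] : [/\ phi x != 0, phi (phi x) != 0 & phi (phi (phi x)) != 0].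
  by rewrite !frob_eq0.
set N := x * _ * _ * _; have N0 : N != 0 by rewrite !mulf_neq0.
have N1 : phi N = N by rewrite /N !frobE; ring.
rewrite frobM N1 mulf_eq0 negb_or => /(mulfI N0) L1 /andP[_ L0].
by apply: (mulfI L0); rewrite mulr1 -exprS subn1 prednK ?expn_gt0 // -frobQ.
Qed.

(** The sum of x^(-n) h(x)^(q-1) over the units is computed twice: termwise, and with h(x)^(q-1) =
    1. *)
Lemma sum_coef (n : int) : ~~ ((q ^ 4)%:Z - 1 %| n)%Z ->
  \sum_(t <- expansion m | ((q ^ 4)%:Z - 1 %| wt t.2 - n)%Z) t.1 = 0.
Proof.
move=> n0; transitivity (\sum_(x : F | x != 0) x ^ (- n) * laurent (expansion m) x).
  under [RHS]eq_bigr do rewrite mulr_sumr.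
  rewrite exchange_big /= [LHS]big_mkcond; apply: eq_bigr => t _.
  transitivity (t.1 * \sum_(x : F | x != 0) x ^ (wt t.2 - n)).
    by rewrite sum_expz; case: ifP => _; rewrite ?mulr1 ?mulr0.
  rewrite mulr_sumr; apply: eq_bigr => x x0; rewrite mon_wt // addrC expfzDr //; ring.
transitivity (\sum_(x : F | x != 0) x ^ (- n)).
  by apply: eq_bigr => x x0; rewrite laurent_expr1 // mulr1.
by rewrite sum_expz rpredN (negPf n0).
Qed.

(* Two balanced exponent vectors with congruent weights differ by carries x_i^q = x_(i+1);
   k_i below is the carry from position i to position i+1. *)
Lemma carries (d0 d1 d2 d3 e0 e2 : int) :
    balanced m (d0, d1, d2, d3) -> 1 <= e0 <= 3 -> -2 <= e2 <= 0 -> e0 + e2 = 1 ->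
    ((q ^ 4)%:Z - 1 %| wt (d0, d1, d2, d3) - wt (e0, (-1)%R, e2, 0%R))%Z ->
  (d0, d1, d2, d3) = (e0, -1, e2, 0) \/
  (d0, d1, d2, d3) = (e0 - q%:Z, 0, e2 + q%:Z, -1) /\ e2 < 0.
Proof.
move=> /and5P[/eqP sum_d b0 b1 b2 b3] le_e0 le_e2 sum_e /dvdzP[k3].
rewrite /wt => wtE.
have q8 : 8 <= q%:Z by have : (8 <= q)%N := leq_pexp2l (isT : (0 < 2)%N) m_gt2; lia.
have qE : 2 ^+ m = q%:Z by rewrite -natz natrX.
rewrite qE in b0 b1 b2 b3.
have q4 : (q ^ 4)%:Z = q%:Z * (q%:Z * (q%:Z * q%:Z)).
  by rewrite !expnS expn0 muln1 !PoszM.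
rewrite {}q4 in wtE; move: (Posz q) q8 b0 b1 b2 b3 wtE {qE} => Q q8 b0 b1 b2 b3 wtE.
(* The quotient [k3] by q^4 - 1 is the carry out of the top position, which re-enters at position 0;
   the others follow from the top digit down. *)
pose k2 := Q * k3 - d3; pose k1 := Q * k2 - (d2 - e2); pose k0 := Q * k1 - (d1 + 1).
have E3 : d3 = 0 + Q * k3 - k2 by rewrite /k2; ring.
have E2 : d2 = e2 + Q * k2 - k1 by rewrite /k1; ring.
have E1 : d1 = -1 + Q * k1 - k0 by rewrite /k0; ring.
have E0 : d0 = e0 + Q * k0 - k3.
  apply/eqP; rewrite -subr_eq0; apply/eqP; rewrite /k0 /k1 /k2.
  transitivity (d0 + Q * (d1 + Q * (d2 + Q * d3)) - (e0 + Q * (-1 + Q * (e2 + Q * 0)))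
                - k3 * (Q * (Q * (Q * Q)) - 1)); first by ring.
  by rewrite wtE subrr.
clearbody k0 k1 k2; clear wtE.
have Q0 : 0 <= Q by exact: le_trans q8.
have [n0 n1 n2 n3] : [/\ `|e0| <= 3, `|-1 : int| <= 3, `|e2| <= 3 & `|0 : int| <= 3].
  by clear -le_e0 le_e2; split; lia.
have [l0 l1 l2 l3] := carry_bound _ _ _ _ _ q8 (normr_ge0 k0) (normr_ge0 k1) (normr_ge0 k2) (normr_ge0 k3)
  (carry_step _ _ _ _ _ Q0 E0 b0 n0) (carry_step _ _ _ _ _ Q0 E1 b1 n1)
  (carry_step _ _ _ _ _ Q0 E2 b2 n2) (carry_step _ _ _ _ _ Q0 E3 b3 n3).
(* Both exponent vectors have degree 0, so adding the four digit equations leaves (Q - 1) times the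
   sum of the carries. *)
have sum_k : k0 + k1 + k2 + k3 = 0.
  have : (Q - 1) * (k0 + k1 + k2 + k3) = 0.
    transitivity (d0 + d1 + d2 + d3 - (e0 + e2 - 1)); last by rewrite sum_d sum_e; ring.
    by rewrite E0 E1 E2 E3; ring.
  by move/eqP; rewrite mulf_eq0 => /orP[] /eqP // Q1; clear -Q1 q8; lia.
have [] := @carry_cases Q e0 e2 k0 k1 k2 k3 q8 le_e0 le_e2 _ sum_k.
- by rewrite -!ler_norml.
- by rewrite -E0.
- by rewrite -E1.
- by rewrite -E2.
- by rewrite -E3.
- move=> [k00 k10 k20 k30]; left; rewrite E0 E1 E2 E3 k00 k10 k20 k30.
  by congr (_, _, _, _); ring.
- move=> [[k00 k10 k20 k30] e2_lt0]; right; split=> //; rewrite E0 E1 E2 E3 k00 k10 k20 k30.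
  by congr (_, _, _, _); ring.
Qed.

Lemma sum_carries (e0 e2 : int) : 1 <= e0 <= 3 -> -2 <= e2 <= 0 -> e0 + e2 = 1 ->
  C m (e0, -1, e2, 0) + (if e2 < 0 then C m (e0 - q%:Z, 0, e2 + q%:Z, -1) else 0) = 0.
Proof.
move=> le_e0 le_e2 sum_e; set n := wt (e0, (-1)%R, e2, 0%R).
(* Otherwise the balanced vector 0 would be one of the two vectors allowed by [carries]. *)
have n0 : ~~ ((q ^ 4)%:Z - 1 %| n)%Z.
  apply/negP => n0; have bal0 : balanced m (0, 0, 0, 0) by rewrite /balanced normr0 exprn_gt0.
  have wt0 : wt (0, 0, 0, 0) = 0 by rewrite /wt; ring.
  have [] := carries _ _ _ _ _ _ bal0 le_e0 le_e2 sum_e; first by rewrite wt0 sub0r rpredN.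
  - by case.
  - by case; case.
rewrite -[RHS](sum_coef _ n0) /coef [X in X + _]big_mkcond [RHS]big_seq_cond [RHS]big_mkcond /=.
rewrite big_seq_cond [X in X + _]big_mkcond /=.
set D2 := (e0 - _, _, _, _).
have -> : (if e2 < 0 then \sum_(t <- expansion m | t.2 == D2) t.1 else 0) =
    \sum_(t <- expansion m) (if [&& t \in expansion m, e2 < 0 & t.2 == D2] then t.1 else 0).
  case: ifP => _; last by rewrite big1 // => t _; rewrite andbF.
  by rewrite big_seq_cond big_mkcond.
rewrite -big_split; apply: eq_bigr => [[u [[[d0 d1] d2] d3]]] _ /=.
case: (boolP (_ \in _)) => [tE|_]; last by rewrite addr0.
have bal := allP (balanced_expansion m) _ tE.
have [/(carries _ _ _ _ _ _ bal le_e0 le_e2 sum_e)|] := boolP (_ %| _)%Z.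
  case=> [-> | [-> ->]]; rewrite eqxx /=.
    have -> : ((e0, -1, e2, 0) == D2) = false by apply/eqP; case=> _.
    by rewrite andbF addr0.
  have -> : (D2 == (e0, -1, e2, 0)) = false by apply/eqP; case=> _.
  by rewrite add0r.
case: eqP => [[-> -> -> ->]|_]; first by rewrite /n /wt subrr dvdz0.
case: (boolP (e2 < 0)) => //= _; last by rewrite addr0.
rewrite /D2; case: eqP => [[-> -> -> ->]|_]; last by rewrite addr0.
set w := (X in (_ %| X)%Z); have -> : w = 0 by rewrite /w /n /wt; ring.
by rewrite dvdz0.
Qed.


(** * The relations between the parameters *)

(* For x in F_(2^n) this is the absolute trace. *)
Fixpoint atrace n x : F := if n is n'.+1 then x + atrace n' x ^+ 2 else 0.

Lemma sqr_add x y : (x + y) ^+ 2 = x ^+ 2 + y ^+ 2.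
Proof. ring: two0. Qed.

Lemma atrace_sqr n x : atrace n x ^+ 2 = atrace n.+1 x + x.
Proof. by rewrite /= addrAC addFF add0r. Qed.

Lemma atraceS n x : atrace n.+1 x = atrace n x + x ^+ (2 ^ n).
Proof.
elim: n => [|n IH]; first by rewrite /= expr0n /= addr0 add0r expr1.
rewrite -[LHS]/(x + atrace n.+1 x ^+ 2) {1}IH /= expnS mulnC exprM.
ring: two0.
Qed.

Lemma atrace_frob x : atrace m x ^+ 2 = atrace m x + x + phi x.
Proof. by rewrite atrace_sqr atraceS frobQ; ring. Qed.

(** Multiplied by v, the recurrence for f becomes the one defining [atrace] at u v. *)
Lemma atrace_rec (f : nat -> F) u v :
    f 0%N = 0 -> (forall n, f n.+1 = u + v * f n ^+ 2) -> forall n, v * f n = atrace n (u * v).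
Proof.
move=> f0 fS; elim=> [|n IH]; first by rewrite f0 mulr0.
by rewrite fS /= -IH; ring.
Qed.

Lemma coef_e0_e1P n : phi c * C n (1, -1, 0, 0) = atrace n (a * phi c).
Proof.
apply: (atrace_rec (fun n => C n (1, -1, 0, 0))) => [|k]; last exact: coef_e0_e1.
by rewrite /coef big_mkcond big_seq1.
Qed.

Lemma coef_e0_e2P n : phi (phi b) * C n (1, 0, -1, 0) = atrace n (b * phi (phi b)).
Proof.
apply: (atrace_rec (fun n => C n (1, 0, -1, 0))) => [|k]; last exact: coef_e0_e2.
by rewrite /coef big_mkcond big_seq1.
Qed.

Lemma coef_e0_e1_eq0 : C m (1, -1, 0, 0) = 0.
Proof. by have := sum_carries 1 0 isT isT (erefl _); rewrite ltxx addr0. Qed.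

Lemma ac_trace : atrace m (a * phi c) = 0.
Proof. by rewrite -coef_e0_e1P coef_e0_e1_eq0 mulr0. Qed.

(** For T = [atrace m x] one has T^2 = T + x + x^q, so T = 0 puts x into F_q. *)
Lemma ac_frob : phi (a * phi c) = a * phi c.
Proof.
have := atrace_frob (a * phi c); rewrite ac_trace expr0n add0r => /esym /eq_of_add0 e.
by rewrite -e.
Qed.

Lemma a_eq0_of_c : c = 0 -> a = 0.
Proof.
move=> c0; have := coef_e0_e1_eq0; rewrite -(prednK (ltn_trans (isT : 0 < 2)%N m_gt2)) coef_e0_e1 c0.
by rewrite frob0 mul0r addr0.
Qed.

Lemma q_int : 2 ^+ m = q%:Z :> int.
Proof. by rewrite -natz natrX. Qed.

Section Subfield.
Hypotheses (aq : phi a = a) (cq : phi c = c) (a0 : a != 0) (c0 : c != 0).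
Let B := phi (phi b).
Let x := b * B.
Let th := atrace m x.

Lemma coef_relation2 k : m = k.+1 ->
  a * C k (1, -1, 0, 0) ^+ 2 + c * C k (1, 0, -1, 0) ^+ 2 + a * B ^+ (2 ^ k - 1) ^+ 2 = 0.
Proof.
move=> mk; have := sum_carries 2 (-1) isT isT (erefl _).
rewrite -q_int [-1 + _]addrC mk (_ : -1 < 0 = true) // coef_2e0 coef_2carry.
by rewrite !aq !cq.
Qed.

Lemma coef_relation3 k : m = k.+2 ->
  a * C k.+1 (1, 0, -1, 0) ^+ 2
  + c * (a * C k (1, -1, 0, 0) ^+ 2 + c * C k (1, 0, -1, 0) ^+ 2) ^+ 2
  + c * B ^+ (2 ^ k.+1 - 1) ^+ 2 + a * (a * B ^+ (2 ^ k - 1) ^+ 2) ^+ 2 = 0.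
Proof.
move=> mk; have := sum_carries 3 (-2) isT isT (erefl _).
rewrite -q_int [-2 + _]addrC mk (_ : -2 < 0 = true) // coef_3e0 coef_3carry coef_2e0 coef_2carry.
by rewrite !aq !cq addrA.
Qed.

(** For b = 0 the relation with e0 = 2 leaves only f = 0, where c f is the trace of a c truncated by
    one step; the full trace would then be a c, not 0. *)
Lemma b_neq0 : b != 0.
Proof.
apply/eqP => b0; have [k mk] : exists k, m = k.+2 by exists m.-2; move: m_gt2; lia.
have B0 : B = 0 by rewrite /B b0 !frob0.
have := coef_relation2 k.+1 mk; set f := C _ _; set K := B ^+ _.
have -> : K = 0.
  rewrite /K B0 expr0n gtn_eqF // subn_gt0 -{1}(expn0 2) ltn_exp2l //.
rewrite coef_e0_e2 -/B B0 b0 mul0r add0r !expr0n !mulr0 !addr0 => /eqP.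
rewrite mulf_eq0 (negPf a0) expf_eq0 /= => /eqP f0.
have := coef_e0_e1P k.+1; rewrite -/f f0 mulr0 => fE.
have := ac_trace; rewrite cq {1}mk /= -cq -[X in X ^+ 2]/(atrace k.+1 (a * phi c)) -fE expr0n addr0 => /eqP.
by rewrite mulf_eq0 frob_eq0 (negPf a0) (negPf c0).
Qed.

(** The relation with e0 = 2, multiplied by c B^2: then c f and B g are truncated traces and (B K)^2
    = B^q. *)
Lemma relation2 : a ^+ 2 * B ^+ 2 + c ^+ 2 * (th + x) + a * c * phi B = 0.
Proof.
have [k mk] : exists k, m = k.+1 by exists m.-1; rewrite prednK // (ltn_trans _ m_gt2).
have := coef_relation2 k mk; set f := C k _; set g := C k _; set K := B ^+ _ => E.
(* The vanishing trace of a c equals a c + (c f)^2. *)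
have f2 : c ^+ 2 * f ^+ 2 = a * c.
  have := coef_e0_e1P k; rewrite cq -/f => fE.
  have := ac_trace; rewrite cq {1}mk /= -fE => /eq_of_add0 ->; ring.
have g2 : B ^+ 2 * g ^+ 2 = th + x.
  by rewrite -exprMn [B * g]coef_e0_e2P atrace_sqr -mk.
have K2 : B ^+ 2 * K ^+ 2 = phi B.
  rewrite -exprMn /K -exprS -exprM frobQ mk; congr (_ ^+ _).
  have := expn_gt0 2 k; rewrite expnS; lia.
apply: (mulfI c0); rewrite mulr0.
transitivity (c ^+ 2 * B ^+ 2 * (a * f ^+ 2 + c * g ^+ 2 + a * K ^+ 2)); last by rewrite E mulr0.
rewrite -g2 -K2.
transitivity (a * (a * c) * B ^+ 2 + c ^+ 3 * (B ^+ 2 * g ^+ 2) + a * c ^+ 2 * (B ^+ 2 * K ^+ 2)).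
  ring.
by rewrite -f2; ring.
Qed.

(** The relation with e0 = 3 reaches two levels below m, so fourth powers occur; multiplying by c^3
    B^4 again produces traces. *)
Lemma relation3 : a * c ^+ 3 * B ^+ 2 * (th + x) + a ^+ 2 * (a ^+ 2 * c ^+ 2 + a * c) * B ^+ 4
  + c ^+ 6 * (th + x + x ^+ 2) + c ^+ 4 * B ^+ 2 * phi B + a ^+ 3 * c ^+ 3 * phi B = 0.
Proof.
have [k mk] : exists k, m = k.+2 by exists m.-2; move: m_gt2; lia.
have := coef_relation3 k mk; set f := C k _; set g := C k _; set g1 := C k.+1 _.
set K := B ^+ _; set K1 := B ^+ _ => E.
have f4 : c ^+ 4 * f ^+ 4 = a ^+ 2 * c ^+ 2 + a * c.
  have := coef_e0_e1P k; rewrite cq -/f => fE.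
  have := ac_trace; rewrite cq {1}mk /= -fE => /eq_of_add0 ->.
  ring: two0.
have g2 : B ^+ 2 * g1 ^+ 2 = th + x.
  by rewrite -exprMn [B * g1]coef_e0_e2P atrace_sqr -mk.
have g4 : B ^+ 4 * g ^+ 4 = th + x + x ^+ 2.
  rewrite -exprMn [B * g]coef_e0_e2P -[4%N]/(2 * 2)%N exprM !atrace_sqr.
  by rewrite sqr_add atrace_sqr -mk -/x -/th; ring: two0.
have K2 : B ^+ 2 * K ^+ 2 = phi B.
  rewrite -exprMn /K -exprS -exprM frobQ mk; congr (_ ^+ _).
  have := expn_gt0 2 k; rewrite !expnS; lia.
have K4 : B ^+ 4 * K1 ^+ 4 = phi B.
  rewrite -exprMn /K1 -exprS -exprM frobQ mk; congr (_ ^+ _).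
  have := expn_gt0 2 k; rewrite !expnS; lia.
have := congr1 (fun z => c ^+ 3 * B ^+ 4 * z) E; rewrite mulr0 => <-.
rewrite -{1}g2 -f4 -g4 -{1}K2 -K4.
ring: two0.
Qed.

End Subfield.
End Expansion.

(** * Symmetries and the solution *)

Section Mirror.
Variables a b c : F.

Lemma entry1_mirror x : x != 0 ->
  entry1 (phi c) (phi (phi (phi a))) x = entry1 a c x^-1 * (x * phi x) ^+ 2.
Proof.
move=> x0; have x1 : phi x != 0 by rewrite frob_eq0.
by rewrite /entry1 !frobE; field; rewrite x0 x1.
Qed.

Lemma entry2_mirror x : x != 0 -> entry2 (phi (phi b)) x = entry2 b x^-1 * (x * phi (phi x)) ^+ 2.
Proof.
move=> x0; have x2 : phi (phi x) != 0 by rewrite !frob_eq0.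
by rewrite /entry2 !frobE; field; rewrite x0 x2.
Qed.

(** The inversion x -> 1/x negates all exponents of h and so exchanges the roles of a and c. *)
Lemma pfaffian_mirror : (forall x, x != 0 -> pfaffian a b c x != 0) ->
  forall x, x != 0 -> pfaffian (phi c) (phi (phi b)) (phi (phi (phi a))) x != 0.
Proof.
move=> nz x x0; have := nz x^-1; rewrite invr_eq0 => /(_ x0) Gx.
suff -> : pfaffian (phi c) (phi (phi b)) (phi (phi (phi a))) x
    = pfaffian a b c x^-1 * (x * phi x * phi (phi x) * phi (phi (phi x))) ^+ 2.
  by rewrite mulf_neq0 // expf_neq0 // !mulf_neq0 ?frob_eq0.
rewrite /pfaffian entry1_mirror // entry2_mirror // !frobE; ring.
Qed.

(** The substitution x -> r x, by which a is later moved into F_q. *)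
Lemma pfaffian_scale r : r != 0 -> (forall x, x != 0 -> pfaffian a b c x != 0) ->
  forall x, x != 0 -> pfaffian (a * r / phi r) (b * r / phi (phi r)) (c * r / phi (phi (phi r))) x != 0.
Proof.
move=> r0 nz x x0.
have [r1 r2 r3] : [/\ phi r != 0, phi (phi r) != 0 & phi (phi (phi r)) != 0].
  by rewrite !frob_eq0.
have Us : entry1 (a * r / phi r) (c * r / phi (phi (phi r))) x = entry1 a c (r * x) / (r * phi r).
  by rewrite /entry1 !frobE; field; rewrite r0 r1.
have Vs : entry2 (b * r / phi (phi r)) x = entry2 b (r * x) / (r * phi (phi r)).
  by rewrite /entry2 !frobE; field; rewrite r0 r2.
have -> : pfaffian (a * r / phi r) (b * r / phi (phi r)) (c * r / phi (phi (phi r))) x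
    = pfaffian a b c (r * x) / (r * phi r * phi (phi r) * phi (phi (phi r))).
  by rewrite /pfaffian Us Vs !frobE; field; rewrite r0 r1 r2 r3.
by rewrite mulf_neq0 ?nz ?mulf_neq0 // invr_eq0 !mulf_neq0.
Qed.
End Mirror.

Lemma atrace_morph x n : phi (atrace n x) = atrace n (phi x).
Proof. by elim: n => [|n IH] /=; rewrite ?frob0 // frobD frobX IH. Qed.

Lemma sqr_inj x y : x ^+ 2 = y ^+ 2 -> x = y.
Proof.
move=> e; apply/eq_of_add0/eqP; have : (x + y) ^+ 2 == 0 by rewrite sqr_add e addFF.
by rewrite expf_eq0.
Qed.

Lemma cancel_eq0 x y : x != 0 -> x * y = 0 -> y = 0.
Proof. by move=> x0 e; apply: (mulfI x0); rewrite e mulr0. Qed.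

Lemma cancel_sqr_eq0 x y z : x != 0 -> x * (y + z) ^+ 2 = 0 -> y = z.
Proof.
move=> x0 /(cancel_eq0 _ _ x0) e; apply/eq_of_add0/sqr_inj; by rewrite e expr0n.
Qed.

Lemma subfield_solution a b c : (forall x, x != 0 -> pfaffian a b c x != 0) ->
    phi a = a -> phi c = c -> a != 0 -> c != 0 ->
  [/\ phi b = b, b != 0, b ^+ 2 = a * c & (a + c) ^+ 2 = b].
Proof.
move=> nz aq cq a0 c0; have b0 := b_neq0 _ _ _ nz aq cq a0 c0.
have := relation3 _ _ _ nz aq cq a0 c0; have := relation2 _ _ _ nz aq cq a0 c0.
have := pfaffian_mirror _ _ _ nz; rewrite cq !aq => nz'.
have := relation2 _ _ _ nz' cq aq c0 a0.
rewrite frob4 [phi (phi b) * b]mulrC.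
have thE := atrace_frob (b * phi (phi b)).
have := atrace_morph (b * phi (phi b)) m; have := atrace_morph (phi (b * phi (phi b))) m.
have -> : phi (phi (b * phi (phi b))) = b * phi (phi b) by rewrite !frobE mulrC.
move: thE; set th := atrace m (b * _); set th1 := atrace m (phi _) => thE th2 thth1.
have {th2} th2 : phi (phi th) = th by rewrite thth1.
have [B BE] : exists B, B = phi (phi b) by exists (phi (phi b)).
rewrite -!BE => K2' K2 K3.
have B2 : phi (phi B) = b by rewrite BE frob4.
rewrite -BE in thE.
have := congr1 (fun z => phi (phi z)) K2; rewrite !frobE !aq !cq th2 B2 -BE [B * b]mulrC => K2s.
have B0 : B != 0 by rewrite BE !frob_eq0.
(* If a = c, the relations give b^(q^2) = b + 1, and then 1 is a zero of the Pfaffian. *)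
have [ac|ac] := eqVneq a c.
  exfalso; subst a.
  have cB : c ^+ 6 * B ^+ 2 != 0 by rewrite mulf_neq0 ?expf_neq0.
  have : c ^+ 6 * B ^+ 2 * (B + b + 1) ^+ 2 = 0.
    have := congr2 (fun u v => u + (c ^+ 2 * B ^+ 2 + c ^+ 4) * v) K3 K2.
    by rewrite mulr0 addr0 => <-; ring: two0.
  move/(cancel_sqr_eq0 _ _ _ cB) => Bb.
  have := nz 1 (oner_neq0 _); case/negP; apply/eqP.
  rewrite /pfaffian /entry1 /entry2 !(frob1, expr1n, mulr1) cq -BE.
  have -> : c + 1 + c = 1 by ring: two0.
  have -> : b + 1 + B = 0 by rewrite addrAC [b + B]addrC Bb addFF.
  by rewrite !frob1 mul0r addr0 mulr1 addFF.
have d0 : (a + c) ^+ 2 != 0.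
  by rewrite expf_neq0 //; apply: contraNneq ac => /eq_of_add0 ->.
move dE: ((a + c) ^+ 2) d0 => d d0; rewrite sqr_add in dE.
have dq : phi d = d by rewrite -dE !frobE aq cq.
(* [K2s] is the q^2-conjugate of [K2] and [K2'] its mirror image; this combination eliminates th + b
   B, and a <> c allows division by d. *)
have bd : a * c * phi b = d * b ^+ 2.
  apply/eq_of_add0/(mulfI d0); rewrite mulr0.
  have := congr2 (fun u v => a ^+ 2 * u + c ^+ 2 * v) K2s K2'.
  by rewrite !mulr0 addr0 => <-; rewrite -dE; ring: two0.
have Bd : a * c * phi B = d * B ^+ 2.
  by have := congr1 (fun z => phi (phi z)) bd; rewrite !frobE !aq !cq !dq -BE.
have Bb : B = b.
  apply/eq_of_add0/eqP.
  have : c ^+ 2 * (B + b) ^+ 2 = 0.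
    have := congr2 (fun u v => u + v) K2 K2s.
    by rewrite addr0 bd Bd => <-; rewrite -dE; ring: two0.
  by move/(cancel_sqr_eq0 _ _ _ (expf_neq0 2 c0)) ->; rewrite addFF.
have th0 : th = 0.
  apply: (mulfI (expf_neq0 2 c0)); rewrite mulr0 -[RHS]K2s bd Bb -dE; ring: two0.
have bq : phi b = b.
  apply: sqr_inj; apply: eq_of_add0; rewrite addrC !expr2.
  by move: thE; rewrite th0 Bb expr0n /= add0r !frobE => <-.
have bdE : b * d = a * c.
  apply: (mulfI b0); have := bd; rewrite bq => bd'.
  by transitivity (d * b ^+ 2); [ring|rewrite -bd'; ring].
have d2 : d ^+ 2 = a * c.
  (* Multiplied by d^4, [K3] involves b only through b d = a c. *)
  have : a ^+ 2 * c ^+ 4 * d ^+ 2 * (d ^+ 2 + a * c) = 0.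
    have := congr1 (fun u => u * d ^+ 4) K3; rewrite mul0r th0 Bb bq => <-.
    transitivity (a * c ^+ 3 * (b * d) ^+ 4 + a ^+ 2 * (a ^+ 2 * c ^+ 2 + a * c) * (b * d) ^+ 4
      + c ^+ 6 * ((b * d) ^+ 2 * d ^+ 2 + (b * d) ^+ 4) + c ^+ 4 * (b * d) ^+ 3 * d
      + a ^+ 3 * c ^+ 3 * (b * d) * d ^+ 3); last by ring.
    have D2 : d ^+ 2 = a ^+ 4 + c ^+ 4 by rewrite -dE sqr_add; ring.
    have D3 : d ^+ 3 = (a ^+ 2 + c ^+ 2) * (a ^+ 4 + c ^+ 4) by rewrite -D2 dE -exprS.
    by rewrite bdE D3 !D2 -dE; ring: two0.
  by move/cancel_eq0 => e; apply/eq_of_add0/e; rewrite !mulf_neq0 ?expf_neq0.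
have db : d = b by apply: (mulIf d0); rewrite bdE -d2.
by split=> //; rewrite -db.
Qed.

(** * Hilbert 90 and the parameter s for nonzero a *)

Lemma hilbert90 t : t * phi t * phi (phi t) * phi (phi (phi t)) = 1 ->
  exists2 r, r != 0 & t * phi r = r.
Proof.
(* For this resolvent t p(y)^q = p(y) + (N(t) - 1) y = p(y), and p is not identically 0 by
   [qpoly_eq0]. *)
move=> Nt; pose p y := 1 * y + t * phi y + t * phi t * phi (phi y)
  + t * phi t * phi (phi t) * phi (phi (phi y)).
have [/existsP [y py]|] := boolP [exists y, p y != 0].
  exists (p y) => //; transitivity (t * phi t * phi (phi t) * phi (phi (phi t)) * y
    + (p y - y)); last by rewrite Nt; ring.
  by rewrite /p !frobE; ring.
rewrite negb_exists => /forallP p0.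
have [] := qpoly_eq0 1 t (t * phi t) (t * phi t * phi (phi t)).
  by move=> y; apply/eqP; move: (p0 y); rewrite negbK.
by move/eqP; rewrite oner_eq0.
Qed.

Lemma hilbert90_sqr t : t * phi (phi t) = 1 -> exists2 r, r != 0 & t * phi (phi r) = r.
Proof.
move=> Nt; pose p y := 1 * y + 0 * phi y + t * phi (phi y) + 0 * phi (phi (phi y)).
have [/existsP [y py]|] := boolP [exists y, p y != 0].
  exists (p y) => //; rewrite /p !frobE !mul0r mul1r !addr0 mulrDr mulrA Nt; ring.
rewrite negb_exists => /forallP p0; have [] := qpoly_eq0 1 0 t 0.
  by move=> y; apply/eqP; move: (p0 y); rewrite negbK.
by move/eqP; rewrite oner_eq0.
Qed.

Lemma solution_ac a b c : (forall x, x != 0 -> pfaffian a b c x != 0) -> a != 0 ->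
  exists s, let D := 1 + s * phi s * phi (phi s) * phi (phi (phi s)) in
  [/\ D != 0, a = phi s * phi (phi s) * phi (phi (phi s)) / D,
      b = phi (phi s) * phi (phi (phi s)) / D & c = phi (phi (phi s)) / D].
Proof.
move=> nz a0; have c0 : c != 0 by apply: contraNneq a0 => /(a_eq0_of_c _ _ _ nz) ->.
pose N := a * phi a * phi (phi a) * phi (phi (phi a)).
have NQ : phi N = N by rewrite /N !frobE; ring.
(* The norm of a has a fourth root A in F_q, so A / a has norm 1. *)
have [A AQ A4] : exists2 A, phi A = A & A ^+ 4 = N.
  exists (N ^+ (2 ^ (4 * m - 2))); first by rewrite frobX NQ.
  rewrite -exprM -(expnD 2 _ 2) subnK; last by move: m_gt2; lia.
  by rewrite -cardF expf_card.
have [r r0 rE] : exists2 r, r != 0 & A / a * phi r = r.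
  apply: hilbert90; rewrite !frobE !AQ; transitivity (A ^+ 4 / N).
    by rewrite /N; field; rewrite !frob_eq0 ?a0.
  by rewrite A4 divff // /N !mulf_neq0 ?frob_eq0.
have [r1 r2 r3] : [/\ phi r != 0, phi (phi r) != 0 & phi (phi (phi r)) != 0].
  by rewrite !frob_eq0.
have := pfaffian_scale _ _ _ r r0 nz.
have -> : a * r / phi r = A by rewrite -{1}rE; field; rewrite ?a0 ?r1.
set b' := b * r / _; set c' := c * r / _ => nz'.
have A0 : A != 0 by apply: contraNneq r0 => A0; rewrite -rE A0 !mul0r.
have c'0 : c' != 0 by rewrite !mulf_neq0 // invr_eq0.
have c'Q : phi c' = c'.
  (* By [ac_frob], A c'^q lies in F_q, and A does too. *)
  apply: frob_inj; apply: (mulfI A0).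
  by have := ac_frob _ _ _ nz'; rewrite frobM AQ.
have [b'Q b'0 b'2 Ac'] := subfield_solution _ _ _ nz' AQ c'Q A0 c'0.
have aE : a = A * phi r / r by rewrite -{2}rE; field; rewrite a0 A0 r1.
have bE : b = b' * phi (phi r) / r by rewrite /b'; field; rewrite ?r0 ?r2.
have cE : c = c' * phi (phi (phi r)) / r by rewrite /c'; field; rewrite ?r0 ?r3.
clearbody b' c'.
(* Over F_q the parameter is b' / c'; the factor r / r_1 undoes the scaling. *)
exists (b' / c' * r / phi r) => D.
have DE : D = b' / c' ^+ 2.
  rewrite /D !frobE !b'Q !c'Q.
  transitivity (1 + (b' ^+ 2) ^+ 2 / c' ^+ 4); first by field; rewrite ?r0 ?r1 ?r2 ?r3 ?c'0.
  by rewrite b'2 -Ac' sqr_add; field.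
have {b'2} AE : A = b' ^+ 2 / c' by rewrite b'2; field.
rewrite DE !frobE !b'Q !c'Q aE bE cE AE; split.
- by rewrite mulf_neq0 // invr_eq0 expf_neq0.
- by field; rewrite ?r0 ?r1 ?r2 ?r3 ?c'0 ?b'0.
- by field; rewrite ?r0 ?r1 ?r2 ?r3 ?c'0 ?b'0.
- by field; rewrite ?r0 ?r1 ?r2 ?r3 ?c'0 ?b'0.
Qed.

(** * Artin-Schreier equations and the case a = c = 0 *)

Lemma atrace_sum n x : atrace n x = \sum_(i < n) x ^+ (2 ^ i).
Proof. by elim: n => [|n IH]; rewrite ?big_ord0 // atraceS big_ord_recr IH. Qed.

(** The trace polynomial has degree 2^(4m-1), below the size of F, so some trace is nonzero; being
    equal to its square, it is 1. *)
Lemma abs_trace_onto : exists z, atrace (4 * m) z = 1.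
Proof.
have [z tz|t0] := pickP (fun z => atrace (4 * m) z != 0).
  exists z; apply: (mulfI tz); rewrite mulr1 -expr2 atrace_sqr atraceS -cardF expf_card.
  by rewrite -addrA addFF addr0.
pose p : {poly F} := \sum_(i < 4 * m) 'X^(2 ^ i).
have N_gt0 : (0 < 4 * m)%N by move: m_gt2; lia.
have p0 : p != 0.
  apply/eqP => /(congr1 (fun r : {poly F} => r`_1)); rewrite coef0 coef_sum.
  rewrite (bigD1 (Ordinal N_gt0)) //= coefXn big1 ?addr0 => [/eqP|i i0].
    by rewrite oner_eq0.
  have i_gt0 : (0 < i)%N.
    by rewrite lt0n; apply: contra i0 => /eqP i00; apply/eqP/val_inj.
  by rewrite coefXn ltn_eqF // (leq_trans _ (leq_pexp2l (isT : (0 < 2)%N) i_gt0)).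
have size_p : (size p <= (2 ^ (4 * m).-1).+1)%N.
  apply: leq_trans (size_sum _ _ _) _; apply/bigmax_leqP => i _.
  by rewrite size_polyXn ltnS leq_exp2l // -ltnS prednK.
have := max_poly_roots p0 _ (enum_uniq F); rewrite -cardE cardF => /(_ _)/leq_trans/(_ size_p).
rewrite ltnS leq_exp2l // -ltnS prednK // ltnn => contra.
suff /contra : all (root p) (enum F) by [].
apply/allP => z _; apply/rootP; rewrite /p horner_sum.
under eq_bigr do rewrite hornerXn.
by rewrite -atrace_sum; apply/eqP/negbNE; rewrite (t0 z).
Qed.

(* Explicit additive Hilbert 90: u is the sum of atrace i x * z^(2^i), with z of trace 1. *)
Lemma artin_schreier x : atrace (4 * m) x = 0 -> exists u, u ^+ 2 + u = x.
Proof.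
move=> tx; have [z tz] := abs_trace_onto.
pose h i := atrace i x * z ^+ (2 ^ i).
exists (\sum_(i < 4 * m) h i).
have -> : (\sum_(i < 4 * m) h i) ^+ 2 = \sum_(i < 4 * m) h i.+1 + x.
  transitivity (\sum_(i < 4 * m) (h i.+1 + x * (z ^+ (2 ^ i)) ^+ 2)).
    rewrite sum_sqr; apply: eq_bigr => i _.
    rewrite /h exprMn atrace_sqr mulrDl; congr (_ * _ + _).
    by rewrite -exprM -expnSr.
  rewrite big_split -mulr_sumr -sum_sqr -atrace_sum tz expr1n mulr1 //.
have := erefl (\sum_(i < (4 * m).+1) h i); rewrite {1}big_ord_recr big_ord_recl /=.
rewrite /h /= tx !mul0r addr0 add0r => ->.
by rewrite addrAC addFF add0r.
Qed.

(** Let u^2 + u = b b_2. Then u_2 is u or u + 1. In the first case s = u / b works; in the second u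
    / b has norm 1 over F_(q^2), and Hilbert 90 yields a zero of the Pfaffian. *)
Lemma solution_b b : (forall x, x != 0 -> pfaffian 0 b 0 x != 0) ->
  exists s, 1 + s * phi (phi s) != 0 /\ b = phi (phi s) / (1 + s * phi (phi s)).
Proof.
move=> nz; have [->|b0] := eqVneq b 0.
  by exists 0; rewrite !frob0 !mul0r addr0 oner_neq0.
have [b1 b2] : phi b != 0 /\ phi (phi b) != 0 by rewrite !frob_eq0.
pose x := b * phi (phi b).
have x2 : phi (phi x) = x by rewrite /x !frobE mulrC.
(* Since x lies in F_(q^2), the summands i and i + 2m of its trace agree and cancel. *)
have tx : atrace (4 * m) x = 0.
  have -> : (4 * m = (m + m) + (m + m))%N by lia.
  rewrite atrace_sum big_split_ord /=.
  rewrite -[RHS](addFF (\sum_(i < m + m) x ^+ (2 ^ i))); congr (_ + _); apply: eq_bigr => i _.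
  by rewrite expnD exprM expnD exprM -!frobQ x2.
have [u uE] := artin_schreier x tx.
have u2E : phi (phi u) ^+ 2 + phi (phi u) = x by rewrite -x2 -uE !frobE.
have [u2|u2] := eqVneq (phi (phi u)) u.
  have u1 : 1 + u != 0.
    apply/eqP => /eq_of_add0 u1; move/eqP: uE; rewrite -u1 expr1n addFF.
    by rewrite eq_sym /x mulf_eq0 (negPf b0) (negPf b2).
  have u0 : u != 0.
    apply/eqP => u0; move/eqP: uE; rewrite u0 expr0n addr0 eq_sym /x mulf_eq0.
    by rewrite (negPf b0) (negPf b2).
  exists (u / b); rewrite !frobE u2.
  have DE : 1 + u / b * (u / phi (phi b)) = 1 / (1 + u).
    transitivity (1 + u ^+ 2 / x); first by rewrite /x; field; rewrite ?b0 ?b2.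
    have -> : x = u * (1 + u) by rewrite -uE; ring.
    transitivity (1 / (1 + u) + (u / (1 + u) + u / (1 + u))); first by field; rewrite ?u0 ?u1.
    by rewrite addFF addr0.
  rewrite DE; split; first by rewrite mul1r invr_eq0.
  by apply: (mulIf b2); rewrite -/x -uE; field; rewrite oner_neq0 u1.
have {u2} u2 : phi (phi u) = u + 1.
  have : (phi (phi u) + u) * (phi (phi u) + u + 1) = 0.
    transitivity ((phi (phi u) ^+ 2 + phi (phi u)) + (u ^+ 2 + u)); first by ring: two0.
    by rewrite u2E uE addFF.
  have s0 : phi (phi u) + u != 0 by apply: contraNneq u2 => /eq_of_add0 ->.
  by move/(cancel_eq0 _ _ s0) => e; apply: eq_of_add0; rewrite addrA.
have [r r0 rE] : exists2 r, r != 0 & u / b * phi (phi r) = r.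
  apply: hilbert90_sqr; rewrite !frobE u2; transitivity ((u ^+ 2 + u) / x).
    by rewrite /x; field; rewrite ?b0 ?b2.
  by rewrite uE divff // /x mulf_neq0.
have := nz r r0; case/negP; apply/eqP.
have V0 : entry2 b r = 0.
  transitivity ((u ^+ 2 + u + x) / b * phi (phi r) ^+ 2).
    rewrite /entry2 -{1 2}rE !frobE /x; field; exact: b0.
  by rewrite uE addFF !mul0r.
rewrite /pfaffian V0 mul0r addr0 /entry1 !frobE; ring: two0.
Qed.

(** * Regularity of the product *)

(** The identity is an isotopism from field multiplication to [star], which transports the absence
    of zero divisors. *)
Lemma star_regular a b c (L L2 : F -> F) :
    (forall x y, star a b c (L x) (L y) = L2 (x * y)) ->
    {morph L : x y / x + y} -> (forall x, L x = 0 -> x = 0) -> (forall x, L2 x = 0 -> x = 0) ->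
  forall x y, star a b c x y = 0 -> x = 0 \/ y = 0.
Proof.
move=> LE LD L0 L20 x y; have L00 : L 0 = 0 by have := LD 0 0; rewrite addr0 addFF.
have L_inj : injective L by move=> u v e; apply/eq_of_add0/L0; rewrite LD e addFF.
have [g _ gK] := injF_bij L_inj; rewrite -(gK x) -(gK y) LE => /L20 /eqP.
by rewrite mulf_eq0 => /orP[]/eqP ->; rewrite L00; [left|right].
Qed.

(** In characteristic 2, x^q = s x; four iterations return to x, so s has norm 1. *)
Lemma norm1_of_ker s x : x != 0 -> s * x + phi x = 0 ->
  1 + s * phi s * phi (phi s) * phi (phi (phi s)) = 0.
Proof.
move=> x0 /eq_of_add0 x1; apply/(mulIf x0); rewrite mul0r mulrDl mul1r.
transitivity (x + phi (phi (phi s)) * (phi (phi s) * (phi s * (s * x)))); first by ring.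
have x2 : phi s * phi x = phi (phi x) by rewrite -frobM x1.
have x3 : phi (phi s) * phi (phi x) = phi (phi (phi x)) by rewrite -!frobM x1.
have x4 : phi (phi (phi s)) * phi (phi (phi x)) = x by rewrite -!frobM x1 frob4.
by rewrite x1 x2 x3 x4 addFF.
Qed.

Lemma norm1_of_ker2 s x : x != 0 -> s * x + phi (phi x) = 0 -> 1 + s * phi (phi s) = 0.
Proof.
move=> x0 /eq_of_add0 x1; apply/(mulIf x0); rewrite mul0r mulrDl mul1r.
transitivity (x + phi (phi s) * (s * x)); first by ring.
by rewrite x1 -!frobM x1 frob4 addFF.
Qed.

Lemma star_regular_ac s : let D := 1 + s * phi s * phi (phi s) * phi (phi (phi s)) in
  D != 0 ->
  forall x y, star (phi s * phi (phi s) * phi (phi (phi s)) / D)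
    (phi (phi s) * phi (phi (phi s)) / D) (phi (phi (phi s)) / D) x y = 0 -> x = 0 \/ y = 0.
Proof.
move=> D D0; pose t := phi (phi (phi s)).
have Dt : 1 + t * phi t * phi (phi t) * phi (phi (phi t)) = D by rewrite /t /D !frob4; ring.
apply: (star_regular _ _ _ (fun x => t * x + phi x) (fun x => t ^+ 2 * x + phi x)).
- move=> x y; rewrite /star /t !frobE; clear t Dt.
  move: (phi s) (phi (phi s)) (phi (phi (phi s))) @D D0 => s1 s2 s3 D D0.
  move: (phi x) (phi (phi x)) (phi (phi (phi x))) => x1 x2 x3.
  move: (phi y) (phi (phi y)) (phi (phi (phi y))) => y1 y2 y3.
  have E : D * ((s3 * x + x1) * (s3 * y + y1))
      + s1 * s2 * s3 * ((s * x1 + x2) * (s3 * y + y1) + (s3 * x + x1) * (s * y1 + y2))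
      + s2 * s3 * ((s1 * x2 + x3) * (s3 * y + y1) + (s3 * x + x1) * (s1 * y2 + y3))
      + s3 * ((s2 * x3 + x) * (s3 * y + y1) + (s3 * x + x1) * (s2 * y3 + y))
      = D * (s3 ^+ 2 * (x * y) + x1 * y1).
    (* Over the integers the two sides differ by twice this expression. *)
    rewrite -[RHS]addr0 -(addFF (s3 * s3 * x * y + D * s3 * (x * y1 + x1 * y)
      + s * s1 * s2 * s3 * x1 * y1 + s1 * s2 * s3 * (s3 * x2 * y + x2 * y1 + s3 * x * y2 + x1 * y2)
      + s2 * s3 * (s3 * x3 * y + x3 * y1 + s3 * x * y3 + x1 * y3))).
    by rewrite /D; ring.
  by apply: (mulfI D0); rewrite -E; field.
- by move=> x y /=; rewrite !frobE; ring.
- by move=> x /= e; apply: contraNeq D0 => x0; apply/eqP; rewrite -Dt (norm1_of_ker _ _ x0 e).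
- move=> x /= e; apply: contraNeq D0 => x0; apply/eqP/sqr_inj.
  (* The norm of t^2 is the square of that of t, so 1 plus it is D^2. *)
  transitivity (0 : F); last by rewrite expr0n.
  by rewrite -[RHS](norm1_of_ker _ _ x0 e) -Dt !frobX !sqr_add; ring.
Qed.

Lemma star_regular_b s : 1 + s * phi (phi s) != 0 ->
  forall x y, star 0 (phi (phi s) / (1 + s * phi (phi s))) 0 x y = 0 -> x = 0 \/ y = 0.
Proof.
move=> D0; pose t := phi (phi s).
have Dt : 1 + t * phi (phi t) = 1 + s * phi (phi s) by rewrite /t frob4; ring.
apply: (star_regular _ _ _ (fun x => t * x + phi (phi x)) (fun x => t ^+ 2 * x + phi (phi x))).
- move=> x y; rewrite /star /t !frobE !mul0r !addr0; clear t Dt.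
  move: (phi (phi s)) D0 (phi (phi x)) (phi (phi y)) => s2 D0 x2 y2.
  have E : (1 + s * s2) * ((s2 * x + x2) * (s2 * y + y2))
      + s2 * ((s * x2 + x) * (s2 * y + y2) + (s2 * x + x2) * (s * y2 + y))
      = (1 + s * s2) * (s2 ^+ 2 * (x * y) + x2 * y2).
    rewrite -[RHS]addr0 -(addFF ((1 + s * s2) * s2 * (x * y2 + x2 * y)
      + s * s2 * x2 * y2 + s2 * s2 * x * y)); ring.
  by apply: (mulfI D0); rewrite -E; field.
- by move=> x y /=; rewrite !frobE; ring.
- by move=> x /= e; apply: contraNeq D0 => x0; apply/eqP; rewrite -Dt (norm1_of_ker2 _ _ x0 e).
- move=> x /= e; apply: contraNeq D0 => x0; apply/eqP/sqr_inj.
  transitivity (0 : F); last by rewrite expr0n.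
  by rewrite -[RHS](norm1_of_ker2 _ _ x0 e) -Dt !frobX !sqr_add; ring.
Qed.

End Planar.

Theorem theorem1 :
  exists m0 : nat, forall m : nat, (m0 <= m)%N ->
  forall (F : finFieldType), #|F| = (2 ^ (4 * m))%N ->
  let q := (2 ^ m)%N in
  forall a b c : F,
    planar (P4 q a b c) <->
    ((exists s1 : F, 1 + s1 ^+ (1 + q ^ 2) != 0 /\
        (a, b, c) = (0, s1 ^+ (q ^ 2) / (1 + s1 ^+ (1 + q ^ 2)), 0))
     \/
     (exists s2 : F, 1 + s2 ^+ (1 + q + q ^ 2 + q ^ 3) != 0 /\
        (a, b, c) =
        (s2 ^+ (q + q ^ 2 + q ^ 3) / (1 + s2 ^+ (1 + q + q ^ 2 + q ^ 3)),
         s2 ^+ (q ^ 2 + q ^ 3) / (1 + s2 ^+ (1 + q + q ^ 2 + q ^ 3)),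
         s2 ^+ (q ^ 3) / (1 + s2 ^+ (1 + q + q ^ 2 + q ^ 3))))).
Proof.
(* m >= 3 makes q at least 8, as the carry bounds require. *)
exists 3%N => m m_gt2 F cardF q a b c.
have q2 (s : F) : s ^+ (q ^ 2) = frob F m (frob F m s).
  by rewrite !frobQ -exprM -mulnn.
have q3 (s : F) : s ^+ (q ^ 3) = frob F m (frob F m (frob F m s)).
  by rewrite !frobQ -!exprM !expnS expn0 muln1 mulnA.
have q1 (s : F) : s ^+ q = frob F m s by rewrite frobQ.
split=> [pl|[[s [D0 [-> -> ->]]]|[s [D0 [-> -> ->]]]]]; last 2 first.
- rewrite !(exprD, expr1, q2) in D0 *.
  by apply/(planar_star F m cardF)/(star_regular_b F m cardF m_gt2).
- rewrite !(exprD, expr1, q1, q2, q3) in D0 *.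
  by apply/(planar_star F m cardF)/(star_regular_ac F m cardF m_gt2).
have nz := pfaffian_neq0 F m cardF m_gt2 a b c ((planar_star F m cardF a b c).1 pl).
have [a0|a0] := eqVneq a 0.
  (* The mirror image of [a_eq0_of_c] turns a = 0 into c = 0. *)
  left; have c0 : c = 0.
    have := a_eq0_of_c F m cardF m_gt2 _ _ _ (pfaffian_mirror F m cardF m_gt2 _ _ _ nz).
    rewrite a0 !frob0 => /(_ erefl) /eqP; rewrite frob_eq0 => /eqP //.
  subst a c; have [s [D0 ->]] := solution_b F m cardF m_gt2 b nz.
  by exists s; rewrite !(exprD, expr1, q2).
right; have [s [D0 -> -> ->]] := solution_ac F m cardF m_gt2 a b c nz a0.
by exists s; rewrite !(exprD, expr1, q1, q2, q3).
Qed.
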